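(* With the ring $R$ and the ideal $K_l(n,d)$ as defined below, the element $s_n - f_n$ of $R$ lies in $K_l(n,d)$ and has degree $1$, but when it is written as an $R$-linear combination of the listed generators of $K_l(n,d)$, the degree of at least one coefficient is doubly exponential in $n$. In other words, the family $K_l(n,d)$ satisfies the doubly exponential ideal membership property.
   Context: Let $n, d \ge 2$ be integers and $k$ a field. Let $$R = k[s_2, \ldots, s_n, f_2, \ldots, f_n, b_{0i}, \ldots, b_{n-1,i}, c_{1i}, \ldots, c_{n-1,i} \mid i = 1, \ldots, 4],$$ a polynomial ring of dimension $10n-6$ in these variables. The ideal $K_l(n,d)\subseteq R$ is generated by the following elements: $G_{01} = b_{01} b_{03}^d - b_{04} b_{02}^d$; $G_{1i} = c_{1i}(b_{02}-b_{1i} b_{03})$ and $G_{1,4+i} = c_{1i}(b_{01}-b_{1i}^d b_{04})$ for $i = 1, \ldots, 4$; $G_{1ij} = c_{1i} c_{1j}(b_{1i} - b_{1j})$ for $1 \le i < j \le 4$; $G_{21} = b_{04}^d c_{11} - b_{01}^d c_{12}$, $G_{22} = b_{04}^d c_{14} - b_{01}^d c_{13}$, $G_{23} = b_{01}^d (c_{12} -c_{13})$, $G_{24} = b_{04}^d (c_{12} b_{11} -c_{13} b_{14})$; $G_{2,4+i} = b_{04}^d c_{12} c_{2i}(b_{12}-b_{2i} b_{13})$ for $i = 1, \ldots, 4$; $G_{20} = s_2 - c_{11}$, $G_{2,-1} = f_2 - c_{14}$; for $r = 3, \ldots, n-1$: $G_{r0} = s_r - s_{r-1} c_{r-1,1}$,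 $G_{r,-1} = f_r - s_{r-1} c_{r-1,4}$; for $r = 3, \ldots, n$: $G_{r1} = b_{01}^d(f_{r-1} c_{r-1,1} - s_{r-1} c_{r-1,2})$, $G_{r2} = b_{01}^d(f_{r-1} c_{r-1,4} - s_{r-1} c_{r-1,3})$, $G_{r3} = b_{01}^d s_{r-1}(c_{r-1,3} - c_{r-1,2})$, $G_{r4} = b_{01}^d f_{r-1}(c_{r-1,2} b_{r-1,1} - c_{r-1,3} b_{r-1,4})$; for $r = 3, \ldots, n-1$ and $i=1,\ldots,4$: $G_{r,4+i} = b_{01}^d f_{r-1} c_{r-1,2} c_{ri}(b_{r-1,2} - b_{ri} b_{r-1,3})$; $G_{n0} = s_n - s_{n-1} c_{n-1,1} b_{01}^d$, $G_{n,-1} = f_n - s_{n-1} c_{n-1,4} b_{01}^d$, $G_{n5} = b_{01}^d f_{n-1} c_{n-1,2}(b_{n-1,2} - b_{n-1,3})$. The maximal degree of a generator of $K_l(n,d)$ is $d+5$.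
   Formalization: The formal theorem takes n ≥ 3 instead of n ≥ 2: for n = 2 the listed generators involve c_{2i} and s_1, which are not variables of R; ''doubly exponential in n'' is read as 2^(2^⌊n/c⌋) ≤ c(deg+1) for a constant c independent of k, n and d. *)

(* Defs.v *)
From HB Require Import structures.
From mathcomp Require Import all_boot all_order all_algebra.
From mathcomp Require Import mpoly.
Set Implicit Arguments. Unset Strict Implicit. Unset Printing Implicit Defensive.
Import Order.TTheory GRing.Theory Num.Theory.
Local Open Scope ring_scope.

Section KL.
Variables (k : fieldType) (n d : nat).

(* R = k[s_2..s_n, f_2..f_n, b_{0i}..b_{n-1,i}, c_{1i}..c_{n-1,i} | i=1..4],
   with 10n-6 variables. *)
Definition nvars : nat := (10 * n - 6)%N.
Definition Rn := {mpoly k[nvars]}.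

(* the variable with index m (m < nvars always holds in the uses below) *)
Definition var (m : nat) : Rn :=
  if insub m is Some i then 'X_i else 0.

(* Variable indexing:
   s_r    (2 <= r <= n)               |-> r - 2
   f_r    (2 <= r <= n)               |-> (n - 1) + (r - 2)
   b_{j,i} (0 <= j <= n-1, 1<=i<=4)   |-> (2n - 2) + 4 j + (i - 1)
   c_{j,i} (1 <= j <= n-1, 1<=i<=4)   |-> (6n - 2) + 4 (j - 1) + (i - 1) *)
Definition sv (r : nat) : Rn := var (r - 2).
Definition fv (r : nat) : Rn := var (n - 1 + (r - 2)).
Definition bv (j i : nat) : Rn := var (2 * n - 2 + 4 * j + (i - 1)).
Definition cv (j i : nat) : Rn := var (6 * n - 2 + 4 * (j - 1) + (i - 1)).

Definition I4 : seq nat := iota 1 4.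

Definition KL_gens : seq Rn :=
  [:: bv 0 1 * bv 0 3 ^+ d - bv 0 4 * bv 0 2 ^+ d]
  ++ [seq cv 1 i * (bv 0 2 - bv 1 i * bv 0 3) | i <- I4]
  ++ [seq cv 1 i * (bv 0 1 - bv 1 i ^+ d * bv 0 4) | i <- I4]
  ++ flatten [seq [seq cv 1 i * cv 1 j * (bv 1 i - bv 1 j) | j <- iota i.+1 (4 - i)]
                 | i <- I4]
  ++ [:: bv 0 4 ^+ d * cv 1 1 - bv 0 1 ^+ d * cv 1 2;
         bv 0 4 ^+ d * cv 1 4 - bv 0 1 ^+ d * cv 1 3;
         bv 0 1 ^+ d * (cv 1 2 - cv 1 3);
         bv 0 4 ^+ d * (cv 1 2 * bv 1 1 - cv 1 3 * bv 1 4)]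
  ++ [seq bv 0 4 ^+ d * cv 1 2 * cv 2 i * (bv 1 2 - bv 2 i * bv 1 3) | i <- I4]
  ++ [:: sv 2 - cv 1 1; fv 2 - cv 1 4]
  ++ flatten [seq [:: sv r - sv r.-1 * cv r.-1 1; fv r - sv r.-1 * cv r.-1 4]
                 | r <- iota 3 (n - 3)]
  ++ flatten [seq [:: bv 0 1 ^+ d * (fv r.-1 * cv r.-1 1 - sv r.-1 * cv r.-1 2);
                      bv 0 1 ^+ d * (fv r.-1 * cv r.-1 4 - sv r.-1 * cv r.-1 3);
                      bv 0 1 ^+ d * sv r.-1 * (cv r.-1 3 - cv r.-1 2);
                      bv 0 1 ^+ d * fv r.-1 *
                        (cv r.-1 2 * bv r.-1 1 - cv r.-1 3 * bv r.-1 4)]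
                 | r <- iota 3 (n - 2)]
  ++ flatten [seq [seq bv 0 1 ^+ d * fv r.-1 * cv r.-1 2 * cv r i *
                         (bv r.-1 2 - bv r i * bv r.-1 3) | i <- I4]
                 | r <- iota 3 (n - 3)]
  ++ [:: sv n - sv n.-1 * cv n.-1 1 * bv 0 1 ^+ d;
         fv n - sv n.-1 * cv n.-1 4 * bv 0 1 ^+ d;
         bv 0 1 ^+ d * fv n.-1 * cv n.-1 2 * (bv n.-1 2 - bv n.-1 3)].

Definition KL_combination (a : 'I_(size KL_gens) -> Rn) : Rn :=
  \sum_(j < size KL_gens) a j * KL_gens`_j.

Definition in_KL (p : Rn) : Prop :=
  exists a : 'I_(size KL_gens) -> Rn, p = KL_combination a.

(* total degree; msize p = 1 + total degree of p (0 for p = 0) *)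
Definition tdeg (p : Rn) : nat := (msize p).-1.

End KL.

(* Main.v *)
Require Import Defs.
From HB Require Import structures.
From mathcomp Require Import all_boot all_order all_algebra.
From mathcomp Require Import mpoly ring zify.
Local Open Scope ring_scope.
Set Implicit Arguments.
Unset Strict Implicit.
Unset Printing Implicit Defensive.
Import GRing.Theory.

(** All generators of K_l(n,d) are differences of two monomials, so membership
    of s_n - f_n is a question of rewriting s_n into f_n.  As in the
    Mayr-Meyer construction, level j is a counter: modulo the ideal, a pass
    from its start token to its finish token creates b_{j,i} ^+ e_j, with
    e_j = d ^ 2 ^ j, and running the loop of level j for e_j passes of e_j
    steps each gives e_{j+1} = e_j ^ 2.

    For the lower bound, a set of monomials is exhibited that contains s_n but
    not f_n, and that no generator leaves as long as it is multiplied by a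
    monomial of degree less than e_{n-1}.  The sum of the coefficients over
    this set is then a linear form that vanishes on every combination with
    coefficients of degree less than e_{n-1}, but not on s_n - f_n. *)

(** * Congruences modulo an ideal and the squaring step *)

Section IdealCongruence.

Variables (R : comNzRingType) (I : R -> Prop).
Hypothesis I0 : I 0.
Hypothesis ID : forall x y, I x -> I y -> I (x + y).
Hypothesis IM : forall a x, I x -> I (a * x).

Local Notation "x ~~ y" := (I (x - y)) (at level 70).

Lemma congr_sym x y : x ~~ y -> y ~~ x.
Proof. by move=> h; rewrite -opprB -mulN1r; apply: IM. Qed.

Lemma congr_trans y x z : x ~~ y -> y ~~ z -> x ~~ z.
Proof. by move=> h1 h2; rewrite -(subrK y x) -addrA; apply: ID. Qed.

(** The two equations are separate premises so that [ring] can match any arrangement of the factors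
    with a multiple of a known congruence. *)
Lemma congr_mul a u v p q : u ~~ v -> p = a * u -> q = a * v -> p ~~ q.
Proof. by move=> h -> ->; rewrite -mulrBr; apply: IM. Qed.

(** The factor [w] is carried along because the exchange of [b] for [x] is only available in its
    presence, and it cannot in general be cancelled modulo an ideal. *)
Lemma congr_expr w b x m : w * b ~~ w * x -> w * b ^+ m ~~ w * x ^+ m.
Proof.
move=> h; elim: m => [|m IHm]; first by rewrite !expr0 subrr.
apply: (@congr_trans (b * (w * x ^+ m))).
  by apply: (congr_mul (a := b) IHm); rewrite ?exprS; ring.
by apply: (congr_mul (a := x ^+ m) h); rewrite ?exprS; ring.
Qed.

(* One pass of the counter of modulus [e] turns [S * c_i] into
   [F * c_i * b_i ^+ e].  Each turn of the loop trades one [b1] for one [b4]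
   and leaves [x ^+ e] behind; it is run [e] times. *)
Lemma counter_squaring (S F c1 c2 c3 c4 b1 b2 b3 b4 x y : R) e :
    S * c1 ~~ F * c1 * b1 ^+ e -> S * c2 ~~ F * c2 * b2 ^+ e ->
    S * c3 ~~ F * c3 * b3 ^+ e -> S * c4 ~~ F * c4 * b4 ^+ e ->
    F * c1 ~~ S * c2 -> F * c4 ~~ S * c3 -> S * c2 ~~ S * c3 ->
    F * c2 * b1 ~~ F * c3 * b4 -> F * c2 * y * b2 ~~ F * c2 * y * (x * b3) ->
  S * c1 * y ~~ S * c4 * y * x ^+ (e ^ 2).
Proof.
move=> h1 h2 h3 h4 h12 h43 h23 h14 hx.
(* One turn, starting in mode 2: create [b2 ^+ e], exchange each [b2] for [x * b3], cross to mode 3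
   by trading [b1] for [b4], absorb [b3 ^+ e], return to mode 2. *)
have loop : S * c2 * y * b1 ~~ S * c2 * y * (b4 * x ^+ e).
  apply: (@congr_trans (F * c2 * b2 ^+ e * (y * b1))).
    by apply: (congr_mul (a := y * b1) h2); ring.
  apply: (@congr_trans (F * c2 * y * (x * b3) ^+ e * b1)).
    by apply: (congr_mul (a := b1) (congr_expr e hx)); ring.
  rewrite exprMn.
  apply: (@congr_trans (F * c3 * b4 * (y * x ^+ e * b3 ^+ e))).
    by apply: (congr_mul (a := y * x ^+ e * b3 ^+ e) h14); ring.
  apply: (@congr_trans (S * c3 * (b4 * y * x ^+ e))).
    by apply: (congr_mul (a := b4 * y * x ^+ e) (congr_sym h3)); ring.
  by apply: (congr_mul (a := b4 * y * x ^+ e) (congr_sym h23)); ring.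
(* Mode 1 supplies the [b1 ^+ e] that feeds [e] turns, and mode 4 absorbs the [b4 ^+ e] that they
   leave. *)
apply: (@congr_trans (F * c1 * b1 ^+ e * y)).
  by apply: (congr_mul (a := y) h1); ring.
apply: (@congr_trans (S * c2 * y * b1 ^+ e)).
  by apply: (congr_mul (a := b1 ^+ e * y) h12); ring.
apply: (@congr_trans (S * c2 * y * (b4 * x ^+ e) ^+ e)); first exact: congr_expr.
rewrite exprMn -exprM.
apply: (@congr_trans (S * c3 * (y * b4 ^+ e * x ^+ (e * e)))).
  by apply: (congr_mul (a := y * b4 ^+ e * x ^+ (e * e)) h23); ring.
apply: (@congr_trans (F * c4 * (y * b4 ^+ e * x ^+ (e * e)))).
  by apply: (congr_mul (a := y * b4 ^+ e * x ^+ (e * e)) (congr_sym h43)); ring.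
by apply: (congr_mul (a := y * x ^+ (e * e)) (congr_sym h4)); rewrite ?mulnn; ring.
Qed.

End IdealCongruence.

(** * Membership of s_n - f_n in the ideal *)

Section Membership.

Variables (k : fieldType) (n d : nat).
Hypothesis n_ge3 : (3 <= n)%N.

Local Notation sv := (sv k n).
Local Notation fv := (fv k n).
Local Notation bv := (bv k n).
Local Notation cv := (cv k n).
Local Notation gens := (KL_gens k n d).
Local Notation inK := (@in_KL k n d).

Lemma in_KL0 : inK 0.
Proof.
by exists (fun=> 0); rewrite /KL_combination big1 // => j _; rewrite mul0r.
Qed.

Lemma in_KLD p q : inK p -> inK q -> inK (p + q).
Proof.
move=> [a ->] [b ->]; exists (fun j => a j + b j).
by rewrite /KL_combination -big_split; apply: eq_bigr => j _; rewrite mulrDl.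
Qed.

Lemma in_KLM a p : inK p -> inK (a * p).
Proof.
move=> [b ->]; exists (fun j => a * b j).
by rewrite /KL_combination mulr_sumr; apply: eq_bigr => j _; rewrite mulrA.
Qed.

Lemma in_KL_gen g : g \in gens -> inK g.
Proof.
move=> /(nthP 0) [i lti <-]; exists (fun j => (j == Ordinal lti)%:R).
rewrite /KL_combination (bigD1 (Ordinal lti)) //= eqxx mul1r big1 ?addr0 //.
by move=> j /negbTE ->; rewrite mul0r.
Qed.

(* The start and finish tokens of the [j]-th counter, whose modulus is
   [d ^ 2 ^ j]; the variables [s_1] and [f_1] of the Mayr-Meyer ideals are
   played by [b_01 ^+ d] and [b_04 ^+ d]. *)
Definition start j := if j == 1%N then bv 0 1 ^+ d else bv 0 1 ^+ d * sv j.
Definition finish j := if j == 1%N then bv 0 4 ^+ d else bv 0 1 ^+ d * fv j.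

Local Notation "x ~~ y" := (inK (x - y)) (at level 70).

Let trans := congr_trans in_KLD.
Let cmul := congr_mul in_KLM.
Let csym := congr_sym in_KLM.

Tactic Notation "in_block" integer(i) :=
  rewrite /KL_gens; do i (rewrite mem_cat; apply/orP; right);
  rewrite mem_cat; apply/orP; left.

Lemma congr_gen g p q : g \in gens -> p - q = g -> p ~~ q.
Proof. by move=> hg ->; apply: in_KL_gen. Qed.

(** Each of the [d] factors b_01 of the start token becomes b_04 and leaves b_{1i} ^+ d, which makes
    d * d = d ^ 2 ^ 1 in all. *)
Lemma first_counter i : i \in I4 ->
  start 1 * cv 1 i ~~ finish 1 * cv 1 i * bv 1 i ^+ (d ^ 2 ^ 1).
Proof.
move=> hi; rewrite /start /finish /= expn1 -mulnn exprM.
have h : cv 1 i * bv 0 1 ~~ cv 1 i * (bv 1 i ^+ d * bv 0 4).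
  apply: (@congr_gen (cv 1 i * (bv 0 1 - bv 1 i ^+ d * bv 0 4))); last by ring.
  in_block 2.
  exact: (map_f (fun i => cv 1 i * (bv 0 1 - bv 1 i ^+ d * bv 0 4)) hi).
apply: (cmul (a := 1) (congr_expr in_KL0 in_KLD in_KLM d h)); first by ring.
by rewrite exprMn; ring.
Qed.

(** The family indexed by r involves the variables of level r - 1, so level j is served by r = j +
    1. *)
Lemma middle_gen j (g : Rn k n) : (1 < j < n)%N ->
  g \in [:: bv 0 1 ^+ d * (fv j * cv j 1 - sv j * cv j 2);
            bv 0 1 ^+ d * (fv j * cv j 4 - sv j * cv j 3);
            bv 0 1 ^+ d * sv j * (cv j 3 - cv j 2);
            bv 0 1 ^+ d * fv j * (cv j 2 * bv j 1 - cv j 3 * bv j 4)] ->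
  g \in gens.
Proof.
move=> hj hg; in_block 8.
by apply/flatten_mapP; exists j.+1; rewrite ?mem_iota //; lia.
Qed.

Lemma finish_c1 j : (0 < j < n)%N -> finish j * cv j 1 ~~ start j * cv j 2.
Proof.
rewrite /start /finish; case: eqP => [-> _|j1 hj].
  apply: (congr_gen _ (erefl _)); in_block 4; exact: mem_head.
apply: (congr_gen (middle_gen (j := j) _ (mem_head _ _))); first by lia.
by ring.
Qed.

Lemma finish_c4 j : (0 < j < n)%N -> finish j * cv j 4 ~~ start j * cv j 3.
Proof.
rewrite /start /finish; case: eqP => [-> _|j1 hj].
  by apply: (congr_gen _ (erefl _)); in_block 4; rewrite 1!in_cons mem_head !orbT.
apply: (@congr_gen (bv 0 1 ^+ d * (fv j * cv j 4 - sv j * cv j 3))); last by ring.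
by apply: (middle_gen (j := j)); [lia | rewrite in_cons mem_head orbT].
Qed.

Lemma start_c2 j : (0 < j < n)%N -> start j * cv j 2 ~~ start j * cv j 3.
Proof.
rewrite /start; case: eqP => [-> _|j1 hj].
  rewrite -mulrBr; apply: in_KL_gen; in_block 4.
  by rewrite 2!in_cons mem_head !orbT.
apply: csym; rewrite -mulrBr; apply: in_KL_gen; apply: (middle_gen (j := j)).
  by lia.
by rewrite 2!in_cons mem_head !orbT.
Qed.

Lemma finish_c2 j : (0 < j < n)%N ->
  finish j * cv j 2 * bv j 1 ~~ finish j * cv j 3 * bv j 4.
Proof.
rewrite /finish => hj; rewrite -2!mulrA -mulrBr; move: hj; case: eqP => [-> _|j1 hj].
  apply: in_KL_gen; in_block 4; by rewrite 3!in_cons mem_head !orbT.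
apply: in_KL_gen; apply: (middle_gen (j := j)); first by lia.
by rewrite 3!in_cons mem_head !orbT.
Qed.

Lemma finish_c2_next j i : (0 < j < n.-1)%N -> i \in I4 ->
  finish j * cv j 2 * cv j.+1 i * bv j 2
    ~~ finish j * cv j 2 * cv j.+1 i * (bv j.+1 i * bv j 3).
Proof.
rewrite /finish => hj hi; rewrite -mulrBr; move: hj; case: eqP => [-> _|j1 hj].
  apply: in_KL_gen; in_block 5.
  exact: (map_f (fun i => bv 0 4 ^+ d * cv 1 2 * cv 2 i *
                            (bv 1 2 - bv 2 i * bv 1 3)) hi).
apply: in_KL_gen; in_block 9; apply/flatten_mapP; exists j.+1.
  by rewrite mem_iota; lia.
exact: (map_f (fun i => bv 0 1 ^+ d * fv j * cv j 2 * cv j.+1 i *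
                          (bv j 2 - bv j.+1 i * bv j 3)) hi).
Qed.

Lemma start_succ j : (0 < j < n.-1)%N -> start j.+1 ~~ start j * cv j 1.
Proof.
move=> hj; rewrite {1}/start ifN; last by lia.
rewrite /start; case: eqP hj => [-> _|j1 hj].
  apply: (cmul (a := bv 0 1 ^+ d) (u := sv 2) (v := cv 1 1)) => //.
  by apply: in_KL_gen; in_block 6; exact: mem_head.
rewrite -mulrA; apply: (cmul (a := bv 0 1 ^+ d) _ erefl erefl).
apply: in_KL_gen; in_block 7; apply/flatten_mapP; exists j.+1; last exact: mem_head.
by rewrite mem_iota; lia.
Qed.

Lemma finish_succ j : (0 < j < n.-1)%N -> finish j.+1 ~~ start j * cv j 4.
Proof.
move=> hj; rewrite /finish ifN; last by lia.
rewrite /start; case: eqP hj => [-> _|j1 hj].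
  apply: (cmul (a := bv 0 1 ^+ d) (u := fv 2) (v := cv 1 4)) => //.
  by apply: in_KL_gen; in_block 6; rewrite in_cons mem_head orbT.
rewrite -mulrA; apply: (cmul (a := bv 0 1 ^+ d) _ erefl erefl).
apply: in_KL_gen; in_block 7; apply/flatten_mapP; exists j.+1;
  last by rewrite in_cons mem_head orbT.
by rewrite mem_iota; lia.
Qed.

Lemma last_gen (g : Rn k n) :
  g \in [:: sv n - sv n.-1 * cv n.-1 1 * bv 0 1 ^+ d;
            fv n - sv n.-1 * cv n.-1 4 * bv 0 1 ^+ d;
            bv 0 1 ^+ d * fv n.-1 * cv n.-1 2 * (bv n.-1 2 - bv n.-1 3)] ->
  g \in gens.
Proof. by move=> hg; rewrite /KL_gens; do 10 (rewrite mem_cat; apply/orP; right). Qed.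

(** Induction on the level: the start token of level j + 1 is mode 1 of level j and its finish token
    is mode 4, so a pass of level j + 1 is a full run of level j. That run is [counter_squaring]
    with [y] = c_{j+1,i} and [x] = b_{j+1,i}. *)
Lemma counter_pass j i : (0 < j < n)%N -> i \in I4 ->
  start j * cv j i ~~ finish j * cv j i * bv j i ^+ (d ^ 2 ^ j).
Proof.
case: j => // j; elim: j i => [|j IHj] i hj hi; first exact: first_counter.
have hj1 : (0 < j.+1 < n.-1)%N by lia.
have hj2 : (0 < j.+1 < n)%N by lia.
apply: (trans (y := start j.+1 * cv j.+1 1 * cv j.+2 i)).
  by apply: (cmul (a := cv j.+2 i) (start_succ hj1)); ring.
apply: (trans (y := start j.+1 * cv j.+1 4 * cv j.+2 i * bv j.+2 i ^+ (d ^ 2 ^ j.+2))).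
  rewrite [in (2 ^ j.+2)%N]expnSr expnM.
  by apply: (counter_squaring in_KL0 in_KLD in_KLM (IHj 1%N hj2 _) (IHj 2%N hj2 _)
    (IHj 3%N hj2 _) (IHj 4%N hj2 _) (finish_c1 hj2) (finish_c4 hj2) (start_c2 hj2)
    (finish_c2 hj2) (finish_c2_next hj1 hi)).
apply: (cmul (a := cv j.+2 i * bv j.+2 i ^+ (d ^ 2 ^ j.+2))
  (csym (finish_succ hj1))); ring.
Qed.

Lemma sn_fn_in_KL : inK (sv n - fv n).
Proof.
have hn : (0 < n.-1 < n)%N by lia.
have n1 : (n.-1 == 1)%N = false by lia.
have st : start n.-1 = bv 0 1 ^+ d * sv n.-1 by rewrite /start n1.
have fi : finish n.-1 = bv 0 1 ^+ d * fv n.-1 by rewrite /finish n1.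
apply: (trans (y := start n.-1 * cv n.-1 1 * 1)).
  apply: (congr_gen (last_gen (mem_head _ _))); rewrite st; ring.
(* The last generator exchanges b_{n-1,2} for b_{n-1,3} without recording it, so the squaring step
   applies with [x = y = 1] and leaves no power behind. *)
apply: (trans (y := start n.-1 * cv n.-1 4 * 1 * 1 ^+ ((d ^ 2 ^ n.-1) ^ 2))).
  apply: (counter_squaring in_KL0 in_KLD in_KLM (counter_pass (i := 1%N) hn _)
    (counter_pass (i := 2%N) hn _) (counter_pass (i := 3%N) hn _)
    (counter_pass (i := 4%N) hn _) (finish_c1 hn) (finish_c4 hn) (start_c2 hn)
    (finish_c2 hn)) => //.
  apply: (@congr_gen (bv 0 1 ^+ d * fv n.-1 * cv n.-1 2 * (bv n.-1 2 - bv n.-1 3))).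
    by apply: last_gen; rewrite 2!in_cons mem_head !orbT.
  by rewrite fi; ring.
apply: csym; rewrite expr1n.
apply: (@congr_gen (fv n - sv n.-1 * cv n.-1 4 * bv 0 1 ^+ d)); last by rewrite st; ring.
by apply: last_gen; rewrite in_cons mem_head orbT.
Qed.

End Membership.

(** * States of the nested counters *)

Local Open Scope nat_scope.

(* The state of a level of modulus [e] consists of the exponents [c i] and
   [b i] of the variables c_{j,i} and b_{j,i}.  Exactly one [c i] is 1, and [V]
   is how far the counter below has advanced in its current pass.  A pass
   fills (or empties) the register selected by [i]; [level_out] is how far the
   level itself has advanced.  Its truncated subtractions are exact on the
   states that the generators connect. *)
Definition level_ok e V (c b : nat -> nat) :=
  (c 1 + c 2 + c 3 + c 4 == 1) &&
  (if c 1 + c 4 == 1 then [&& b 1 + b 4 == V, b 2 == 0 & b 3 == 0]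
   else (b 1 + b 4 == e) && (b 2 + b 3 == V)).

Definition level_out e (c b : nat -> nat) :=
  if c 1 == 1 then b 4 * e
  else if c 2 == 1 then b 4 * e + b 3
  else if c 3 == 1 then b 4 * e - b 2
  else (e - b 1) * e.

(* A full pass of the last counter would cost degree e_{n-1}, so only its
   first mode is allowed. *)
Definition top_ok V (c b : nat -> nat) :=
  [&& c 1 == 1, c 2 == 0, c 3 == 0 & c 4 == 0] &&
  [&& b 1 == V, b 2 == 0, b 3 == 0 & b 4 == 0].

Lemma top_ok_mode i V c b : 1 < i < 5 -> 0 < c i -> top_ok V c b = false.
Proof.
move=> hi hc; apply/negP; case/andP => /and4P [_ c2 c3 c4] _.
have : [|| i == 2, i == 3 | i == 4] by lia.
by case/or3P => /eqP ei; rewrite ei in hc; lia.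
Qed.

Lemma top_ok_lt V c b : b 1 < V -> top_ok V c b = false.
Proof. by move=> hb; apply/negP; case/andP => _ /and4P [/eqP]; lia. Qed.

Section Runs.

Variables (n d : nat).

Local Notation modulus j := (d ^ 2 ^ j).

Implicit Types (C B : nat -> nat -> nat).

Fixpoint run k j V C B :=
  if k is k'.+1 then
    level_ok (modulus j) V (C j) (B j) &&
    run k' j.+1 (level_out (modulus j) (C j) (B j)) C B
  else top_ok V (C j) (B j).

(* Level 0: the degree [d] in b_01 and b_04 is conserved, and trading one b_01
   for one b_04 advances the counter by [d]. *)
Definition valid C B :=
  [&& B 0 2 == 0, B 0 3 == 0, B 0 1 + B 0 4 == d & run n.-2 1 (B 0 4 * d) C B].

Lemma level_ok_ext e V c b c' b' : c =1 c' -> b =1 b' ->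
  level_ok e V c b = level_ok e V c' b'.
Proof. by move=> hc hb; rewrite /level_ok !hc !hb. Qed.

Lemma level_out_ext e c b c' b' : c =1 c' -> b =1 b' ->
  level_out e c b = level_out e c' b'.
Proof. by move=> hc hb; rewrite /level_out !hc !hb. Qed.

Lemma run_ext k j V C B C' B' :
    (forall l, j <= l -> C l =1 C' l) -> (forall l, j <= l -> B l =1 B' l) ->
  run k j V C B = run k j V C' B'.
Proof.
elim: k j V => [|k IHk] j V hC hB /=; first by rewrite /top_ok !hC ?hB.
rewrite (level_ok_ext _ _ (hC j _) (hB j _)) //.
rewrite (level_out_ext _ (hC j _) (hB j _)) //.
by rewrite IHk // => l jl; [apply: hC | apply: hB]; lia.
Qed.

(** For moves confined to one level: mode and incoming counter value may both change, but higher
    levels see only the output. *)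
Lemma run_local k j V V' C B C' B' :
    level_ok (modulus j) V (C j) (B j) = level_ok (modulus j) V' (C' j) (B' j) ->
    (level_ok (modulus j) V (C j) (B j) ->
      level_out (modulus j) (C j) (B j) = level_out (modulus j) (C' j) (B' j)) ->
    (forall l, j < l -> C l =1 C' l) -> (forall l, j < l -> B l =1 B' l) ->
  run k.+1 j V C B = run k.+1 j V' C' B'.
Proof.
move=> hok hout hC hB /=; rewrite -hok; case: level_ok hout => //= -> //.
exact: run_ext.
Qed.

(* The counter value entering a level and the contents of the register
   selected there move together, and do not affect what leaves the level. *)
Lemma run_shift t i k j V C B C' B' : 0 < i < 5 -> 0 < C j i ->
    (forall l, j <= l -> C' l =1 C l) ->
    (forall i', B' j i' = B j i' + (i' == i) * t) ->
    (forall l, j < l -> B' l =1 B l) ->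
  run k j (V + t) C' B' = run k j V C B.
Proof.
move=> hi hc hC hB hB'.
have hi4 : [|| i == 1, i == 2, i == 3 | i == 4] by lia.
have ok (e : nat) : level_ok e (V + t) (C' j) (B' j) = level_ok e V (C j) (B j).
  rewrite /level_ok !hC // !hB.
  case: eqP => //= h1; case/or4P: hi4 => /eqP ei; rewrite ei in hc *; case: ifP => ?; lia.
(* In mode [i] the formula for the output does not mention the register [b i], which is the one
   being filled. *)
have out (e : nat) : level_ok e V (C j) (B j) ->
    level_out e (C' j) (B' j) = level_out e (C j) (B j).
  rewrite /level_ok /level_out !hC // !hB => /andP [/eqP h1 _].
  case/or4P: hi4 => /eqP ei; rewrite ei in hc *; do ?case: ifP => ?; lia.
case: k => [|k] /=.
  rewrite /top_ok !hC // !hB.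
  case/or4P: hi4 => /eqP ei; rewrite ei in hc *; lia.
rewrite ok; case E: level_ok => //=; rewrite out //.
by apply: run_ext => l jl; [apply: hC; lia | apply: hB'].
Qed.

Definition clean_level (c b : nat -> nat) :=
  all (fun i => (c i == 0) && (b i == 0)) (iota 1 4).

Arguments clean_level : simpl never.

Definition clean l j C B := all (fun t => clean_level (C t) (B t)) (index_iota l j).

(** The extra c_{t,1} is already the only mode allowed, and counter value 0 forces empty registers,
    so the rest of the state must be trivial at level t. The output is then again 0, and the
    argument repeats one level up. *)
Lemma run_ones k p l j C C' B B' : l + p = j ->
    (forall t, l <= t < j -> forall i, C' t i = C t i + (i == 1)) ->
    (forall t, l <= t < j -> B' t =1 B t) ->
  run (p + k) l 0 C' B' = clean l j C B && run k j 0 C' B'.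
Proof.
elim: p l => [|p IHp] l /=.
  by rewrite addn0 => -> _ _; rewrite /clean /index_iota subnn.
move=> hj hC hB; rewrite /clean /index_iota (_ : j - l = (j - l.+1).+1); last by lia.
rewrite [all _ _]/= -/(index_iota l.+1 j) -/(clean l.+1 j C B) -andbA.
rewrite -IHp; try by [lia | move=> t ht; (apply: hC || apply: hB); lia].
have hc i : C' l i = C l i + (i == 1) by apply: hC; lia.
have hb i : B' l i = B l i by apply: hB; lia.
have -> : level_ok (modulus l) 0 (C' l) (B' l) = clean_level (C l) (B l).
  by rewrite /level_ok /clean_level /= !hc !hb; case: ifP => ?; lia.
case E: clean_level => //=; congr (run _ _ _ _ _).
by move: E; rewrite /clean_level /level_out /= !hc !hb; do ?case: ifP => ?; lia.
Qed.

Lemma clean_recr l j C B : l <= j ->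
  clean l j.+1 C B = clean l j C B && clean_level (C j) (B j).
Proof.
move=> lj; rewrite /clean /index_iota subSn // -addn1 iotaD all_cat subnKC //.
by rewrite [all _ (iota _ 1)]/= andbT.
Qed.

(** The factor b_01 ^+ d exhausts the degree allowed at level 0, so level 1 receives 0; the modes
    c_{l,1} of the token hand this 0 on to level j. *)
Lemma valid_start j C B C' B' : 0 < j < n ->
    (forall i, B' 0 i = B 0 i + (i == 1) * d) ->
    (forall l, 0 < l < j -> forall i, C' l i = C l i + (i == 1)) ->
    (forall l, 0 < l < j -> B' l =1 B l) ->
  valid C' B' = clean_level (fun=> 0) (B 0) && clean 1 j C B && run (n.-1 - j) j 0 C' B'.
Proof.
move=> hj hB0 hC hB; rewrite /valid !hB0 -andbA.
rewrite -(run_ones (p := j.-1) _ _ hC hB); last by lia.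
rewrite (_ : j.-1 + (n.-1 - j) = n.-2); last by lia.
rewrite /clean_level /=.
case: (B 0 4) => [|b4]; last by rewrite /= !andbF //; lia.
by rewrite addn0 mul0n; case: (run _ _ _ _ _); lia.
Qed.

Lemma valid_finish j C B C' B' : 0 < d -> 0 < j < n ->
    (forall i, B' 0 i = B 0 i + (i == if j == 1 then 4 else 1) * d) ->
    (forall l, 0 < l < j -> forall i,
      C' l i = C l i + (i == if l.+1 == j then 4 else 1)) ->
    (forall l, 0 < l < j -> B' l =1 B l) ->
  valid C' B' =
    clean_level (fun=> 0) (B 0) && clean 1 j C B && run (n.-1 - j) j (modulus j) C' B'.
Proof.
move=> d0 hj; case: eqP => [->|j1] hB0 hC hB.
  rewrite /valid !hB0 /clean /index_iota subnn /clean_level /= expn1 andbT.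
  rewrite (_ : n.-1 - 1 = n.-2) -?mulnn; last by lia.
  rewrite mulnDl mul1n /= !mul0n !addn0.
  case: (B 0 4) => [|b4]; last by rewrite (_ : (_ == d) = false) ?andbF //; lia.
  by rewrite mul0n add0n; case: (run _ _ _ _ _); lia.
have [i ej] : exists i, j = i.+2 by exists j.-2; lia.
subst j => {j1}.
rewrite (valid_start (j := i.+1) (C := C) (B := B)) //; first last.
- by move=> l hl; apply: hB; lia.
- by move=> l hl i0; rewrite hC ?ifN //; lia.
- by lia.
rewrite (_ : n.-1 - i.+1 = (n.-1 - i.+2).+1); last by lia.
rewrite (clean_recr (j := i.+1)) //; case: (clean_level (fun=> 0) _) => //=.
case: clean => //=.
have hc i0 : C' i.+1 i0 = C i.+1 i0 + (i0 == 4) by rewrite hC ?eqxx //; lia.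
have hb i0 : B' i.+1 i0 = B i.+1 i0 by apply: hB; lia.
have -> : level_ok (modulus i.+1) 0 (C' i.+1) (B' i.+1) = clean_level (C i.+1) (B i.+1).
  by rewrite /level_ok /clean_level /= !hc !hb; case: ifP => ?; lia.
case E: clean_level => //=; congr (run _ _ _ _ _).
move: E; rewrite /clean_level /level_out /= !hc !hb => E.
rewrite (_ : B i.+1 1 = 0); last by lia.
by do ?case: ifP => ?; rewrite ?subn0 ?mulnn -?expnM -?expnSr //; lia.
Qed.

(** * Moves of a single counter below the top *)

Section Moves.

Variables (k j : nat) (C B C1 B1 C2 B2 : nat -> nat -> nat).

(** A completed pass in mode 1 and a fresh pass in mode 2 impose the same conditions: [b 1 + b 4] is
    the modulus and [b 2], [b 3] vanish. Both outputs are then [b 4] times the modulus. *)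
Lemma run_finish_c1 :
    (forall i, C1 j i = C j i + (i == 1)) -> (forall i, C2 j i = C j i + (i == 2)) ->
    B1 j =1 B2 j ->
    (forall l, j < l -> C1 l =1 C2 l) -> (forall l, j < l -> B1 l =1 B2 l) ->
  run k.+1 j (modulus j) C1 B1 = run k.+1 j 0 C2 B2.
Proof.
move=> h1 h2 hB hC' hB'; apply: run_local => //;
  rewrite /level_ok /level_out !h1 !h2 !hB /=.
  by do ?case: ifP => ?; lia.
by do ?case: ifP => ?; lia.
Qed.

(** As for mode 1, but the outputs agree because [b 1 + b 4] is the modulus, so that [b 4] equals
    the modulus minus [b 1]. *)
Lemma run_finish_c4 :
    (forall i, C1 j i = C j i + (i == 4)) -> (forall i, C2 j i = C j i + (i == 3)) ->
    B1 j =1 B2 j ->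
    (forall l, j < l -> C1 l =1 C2 l) -> (forall l, j < l -> B1 l =1 B2 l) ->
  run k.+1 j (modulus j) C1 B1 = run k.+1 j 0 C2 B2.
Proof.
move=> h1 h2 hB hC' hB'; apply: run_local => //;
  rewrite /level_ok /level_out !h1 !h2 !hB /=.
  by do ?case: ifP => ?; lia.
move=> E; rewrite (_ : modulus j - B2 j 1 = B2 j 4); last by move: E; case: ifP => ?; lia.
by move: E; do ?case: ifP => ?; lia.
Qed.

Lemma run_start_c2 :
    (forall i, C1 j i = C j i + (i == 3)) -> (forall i, C2 j i = C j i + (i == 2)) ->
    B1 j =1 B2 j ->
    (forall l, j < l -> C1 l =1 C2 l) -> (forall l, j < l -> B1 l =1 B2 l) ->
  run k.+1 j 0 C1 B1 = run k.+1 j 0 C2 B2.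
Proof.
move=> h1 h2 hB hC' hB'; apply: run_local => //;
  rewrite /level_ok /level_out !h1 !h2 !hB /=.
  by do ?case: ifP => ?; lia.
by do ?case: ifP => ?; lia.
Qed.

(** Passing to mode 3 raises [b 4] by one and so adds e to the output, while [+ b 3] becomes
    [- b 2]; these balance since [b 2 + b 3 = e] after a completed pass. *)
Lemma run_finish_c2 :
    (forall i, C1 j i = C j i + (i == 2)) -> (forall i, C2 j i = C j i + (i == 3)) ->
    (forall i, B1 j i = B j i + (i == 1)) -> (forall i, B2 j i = B j i + (i == 4)) ->
    (forall l, j < l -> C1 l =1 C2 l) -> (forall l, j < l -> B1 l =1 B2 l) ->
  run k.+1 j (modulus j) C1 B1 = run k.+1 j (modulus j) C2 B2.
Proof.
move=> h1 h2 g1 g2 hC' hB'; apply: run_local => //;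
  rewrite /level_ok /level_out !h1 !h2 !g1 !g2 /=.
  by do ?case: ifP => ?; lia.
by do ?case: ifP => ?; lia.
Qed.

(** Trading [b 2] for [b 3] in mode 2 raises the output by one, and the new factor b_{j+1,i} fills
    the selected register of the next level by one. *)
Lemma run_finish_c2_next i : 0 < i < 5 ->
    (forall i', C1 j i' = C j i' + (i' == 2)) -> (forall l, j <= l -> C2 l =1 C1 l) ->
    0 < C1 j.+1 i ->
    (forall i', B1 j i' = B j i' + (i' == 2)) -> (forall i', B2 j i' = B j i' + (i' == 3)) ->
    (forall i', B2 j.+1 i' = B1 j.+1 i' + (i' == i)) ->
    (forall l, j.+1 < l -> B2 l =1 B1 l) ->
  run k.+1 j (modulus j) C1 B1 = run k.+1 j (modulus j) C2 B2.
Proof.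
move=> hi h1 h2 hc g1 g2 hB hB' /=.
have -> : level_ok (modulus j) (modulus j) (C2 j) (B2 j) =
    level_ok (modulus j) (modulus j) (C1 j) (B1 j).
  by rewrite /level_ok !h2 // !h1 !g1 !g2 /=; do ?case: ifP => ?; lia.
case E: level_ok => //=.
have -> : level_out (modulus j) (C2 j) (B2 j) = level_out (modulus j) (C1 j) (B1 j) + 1.
  move: E; rewrite /level_ok /level_out !h2 // !h1 !g1 !g2 /=.
  by do ?case: ifP => ?; lia.
rewrite (@run_shift 1 i k j.+1 _ C1 B1 C2 B2) //.
  by move=> l hl; apply: h2; lia.
by move=> i'; rewrite hB muln1.
Qed.

End Moves.

End Runs.

Local Close Scope nat_scope.

(** * Sums of coefficients over a set of monomials *)

Section CoefficientSum.

Variables (k : fieldType) (N : nat) (S : pred 'X_{1..N}).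

Definition msum (p : {mpoly k[N]}) := \sum_(m <- msupp p | S m) p@_m.

Lemma msum_widen s p : uniq s -> {subset msupp p <= s} ->
  msum p = \sum_(m <- s | S m) p@_m.
Proof.
move=> us sub; rewrite [RHS](bigID (fun m => m \in msupp p)) /= [X in _ + X]big1.
  rewrite addr0 /msum [RHS]big_andbC -[RHS]big_filter_cond.
  apply: perm_big; apply: uniq_perm; rewrite ?filter_uniq // => m.
  by rewrite mem_filter; case: (boolP (m \in msupp p)) => // /sub ->.
by move=> m /andP [_]; apply: memN_msupp_eq0.
Qed.

Lemma msum0 : msum 0 = 0.
Proof. by rewrite /msum big1 // => m _; rewrite mcoeff0. Qed.

Lemma msumD p q : msum (p + q) = msum p + msum q.
Proof.
pose s := undup (msupp p ++ msupp q); have us : uniq s by apply: undup_uniq.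
have sp : {subset msupp p <= s} by move=> m; rewrite mem_undup mem_cat => ->.
have sq : {subset msupp q <= s}.
  by move=> m; rewrite mem_undup mem_cat orbC => ->.
have spq : {subset msupp (p + q) <= s}.
  by move=> m /msuppD_le; rewrite mem_undup.
rewrite !(msum_widen us) // -big_split; apply: eq_bigr => m _; exact: mcoeffD.
Qed.

Lemma msumZ c p : msum (c *: p) = c * msum p.
Proof.
rewrite (msum_widen (msupp_uniq p)); last exact: msuppZ_le.
by rewrite mulr_sumr; apply: eq_bigr => m _; rewrite mcoeffZ.
Qed.

Lemma msumB p q : msum (p - q) = msum p - msum q.
Proof. by rewrite -scaleN1r msumD msumZ mulN1r. Qed.

Lemma msumX m : msum 'X_[m] = (S m)%:R.
Proof. by rewrite /msum msuppX big_mkcond big_seq1 mcoeffX eqxx; case: S. Qed.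

(** Agreement is required only for monomials in the support of [a], which is where a degree bound on
    a coefficient can enter. *)
Lemma msum_binomial a u v :
    (forall m, m \in msupp a -> S (m + u)%MM = S (m + v)%MM) ->
  msum (a * ('X_[u] - 'X_[v])) = 0.
Proof.
move=> h; rewrite {1}[a]mpolyE mulr_suml (big_morph _ msumD msum0).
rewrite big1_seq // => m /andP [_ hm].
by rewrite -scalerAl msumZ mulrBr -!mpolyXD msumB !msumX h // subrr mulr0.
Qed.

End CoefficientSum.

(** * Exponents of monomials after substitution *)

Section Exponents.

Variables (k : fieldType) (n d : nat).
Hypothesis n_ge3 : (3 <= n)%N.
Hypothesis d_ge2 : (2 <= d)%N.

Local Notation N := (nvars n).
Local Open Scope nat_scope.

Definition mv idx : 'X_{1..N} := if insub idx is Some i then U_(i)%MM else 0%MM.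

Lemma var_mv idx : idx < N -> var k n idx = 'X_[mv idx].
Proof. by rewrite /var /mv => lt; rewrite insubT. Qed.

(** Under a substitution of monomials for variables each new exponent is a linear function of the
    old ones; [w idx] is the share of the variable with index [idx]. *)
Definition weight (w : nat -> nat) (m : 'X_{1..N}) := \sum_(i < N) m i * w i.

Lemma weightD w m m' : weight w (m + m')%MM = weight w m + weight w m'.
Proof.
by rewrite -big_split; apply: eq_bigr => i _; rewrite mnmDE mulnDl.
Qed.

Lemma weight0 w : weight w 0%MM = 0.
Proof. by rewrite /weight big1 // => i _; rewrite mnm0E. Qed.

Lemma weightMn w m t : weight w (m *+ t)%MM = weight w m * t.
Proof. by rewrite /weight big_distrl; apply: eq_bigr => i _; rewrite mulmnE mulnAC. Qed.

Lemma weight_mv w idx : idx < N -> weight w (mv idx) = w idx.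
Proof.
move=> lt; rewrite /weight /mv insubT (bigD1 (Sub idx lt)) //= big1 ?addn0.
  by rewrite mnm1E eqxx mul1n.
by move=> i /negbTE ni; rewrite mnm1E eq_sym ni.
Qed.

Lemma leq_weight w m : (forall i, w i <= 1) -> weight w m <= mdeg m.
Proof.
move=> hw; rewrite mdegE; apply: leq_sum => i _.
by rewrite -[leqRHS]muln1 leq_mul.
Qed.

Definition sidx r := r - 2.
Definition fidx r := n - 1 + (r - 2).
Definition bidx j i := 2 * n - 2 + 4 * j + (i - 1).
Definition cidx j i := 6 * n - 2 + 4 * (j - 1) + (i - 1).

(* Exponents after the substitutions s_r := c_{1,1} ... c_{r-1,1} and
   f_r := c_{1,1} ... c_{r-2,1} c_{r-1,4}, with an extra factor b_{01} ^+ d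
   when r = n. *)
Definition wC j i idx : nat :=
  [&& 0 < j, 0 < i < 5 &
    if idx < n - 1 then (i == 1) && (j < idx + 2)
    else if idx < 2 * n - 2 then
      (i == 1) && (j.+1 < idx - (n - 1) + 2) || (i == 4) && (j.+1 == idx - (n - 1) + 2)
    else idx == cidx j i].

(** The indices n - 2 and 2n - 3 are those of s_n and f_n, the variables whose substitution brings
    in b_01 ^+ d. *)
Definition wB j i idx : nat :=
  if idx < 2 * n - 2 then
    ((idx == n - 2) || (idx == 2 * n - 3)) * ((j == 0) && (i == 1)) * d
  else [&& j < n, 0 < i < 5 & idx == bidx j i].

Definition cexp m j i := weight (wC j i) m.
Definition bexp m j i := weight (wB j i) m.

Definition ms r := mv (sidx r).
Definition mf r := mv (fidx r).
Definition mb j i := mv (bidx j i).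
Definition mc j i := mv (cidx j i).

Lemma cexp_ms r l i : 1 < r <= n -> cexp (ms r) l i = [&& 0 < l, i == 1 & l < r] :> nat.
Proof. by move=> hr; rewrite /cexp /ms /sidx weight_mv /wC ?ifT; rewrite /nvars; lia. Qed.

Lemma cexp_mf r l i : 1 < r <= n ->
  cexp (mf r) l i =
    [&& 0 < l, l.+1 < r & i == 1] + [&& 0 < l, l.+1 == r & i == 4].
Proof.
move=> hr; rewrite /cexp /mf /fidx weight_mv /wC; last by rewrite /nvars; lia.
rewrite ifN; last by lia.
by rewrite ifT; lia.
Qed.

Lemma cexp_mb j i0 l i : j < n -> 0 < i0 < 5 -> cexp (mb j i0) l i = 0.
Proof.
move=> hj hi; rewrite /cexp /mb /bidx weight_mv /wC; last by rewrite /nvars; lia.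
by rewrite ifN ?ifN /cidx; lia.
Qed.

Lemma cexp_mc j i0 l i : 0 < j < n -> 0 < i0 < 5 ->
  cexp (mc j i0) l i = (l == j) && (i == i0) :> nat.
Proof.
move=> hj hi; rewrite /cexp /mc /cidx weight_mv /wC; last by rewrite /nvars; lia.
by rewrite ifN ?ifN /cidx; lia.
Qed.

Lemma bexp_ms r l i : 1 < r <= n ->
  bexp (ms r) l i = [&& r == n, l == 0 & i == 1] * d.
Proof.
move=> hr; rewrite /bexp /ms /sidx weight_mv /wB; last by rewrite /nvars; lia.
by rewrite ifT; [congr (_ * _); lia | lia].
Qed.

Lemma bexp_mf r l i : 1 < r <= n ->
  bexp (mf r) l i = [&& r == n, l == 0 & i == 1] * d.
Proof.
move=> hr; rewrite /bexp /mf /fidx weight_mv /wB; last by rewrite /nvars; lia.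
by rewrite ifT; [congr (_ * _); lia | lia].
Qed.

Lemma bexp_mb j i0 l i : j < n -> 0 < i0 < 5 ->
  bexp (mb j i0) l i = (l == j) && (i == i0) :> nat.
Proof.
move=> hj hi; rewrite /bexp /mb /bidx weight_mv /wB; last by rewrite /nvars; lia.
by rewrite ifN /bidx; lia.
Qed.

Lemma bexp_mc j i0 l i : 0 < j < n -> 0 < i0 < 5 -> bexp (mc j i0) l i = 0.
Proof.
move=> hj hi; rewrite /bexp /mc /cidx weight_mv /wB; last by rewrite /nvars; lia.
by rewrite ifN /bidx; lia.
Qed.

(** Turns the degree of a multiplier into a bound on its registers. Level 0 is excluded because s_n
    and f_n contribute [d] there. *)
Lemma bexp_le m l i : 0 < l -> bexp m l i <= mdeg m.
Proof.
move=> hl; apply: leq_weight => idx; rewrite /wB; case: ifP => _; last by lia.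
by rewrite (_ : (l == 0) = false) ?muln0; lia.
Qed.

Lemma cexpD m m' l i : cexp (m + m')%MM l i = cexp m l i + cexp m' l i.
Proof. exact: weightD. Qed.

Lemma bexpD m m' l i : bexp (m + m')%MM l i = bexp m l i + bexp m' l i.
Proof. exact: weightD. Qed.

Lemma cexpMn m t l i : cexp (m *+ t)%MM l i = cexp m l i * t.
Proof. exact: weightMn. Qed.

Lemma bexpMn m t l i : bexp (m *+ t)%MM l i = bexp m l i * t.
Proof. exact: weightMn. Qed.

Definition mstart j := if j == 1 then (mb 0 1 *+ d)%MM else (mb 0 1 *+ d + ms j)%MM.
Definition mfinish j := if j == 1 then (mb 0 4 *+ d)%MM else (mb 0 1 *+ d + mf j)%MM.

Lemma cexp_mstart j l i : 0 < j < n ->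
  cexp (mstart j) l i = [&& 0 < l, i == 1 & l < j] :> nat.
Proof.
move=> hj; rewrite /mstart; case: eqP => [->|j1]; rewrite ?cexpD cexpMn.
  by rewrite cexp_mb; lia.
by rewrite cexp_mb ?cexp_ms; lia.
Qed.

Lemma cexp_mfinish j l i : 0 < j < n ->
  cexp (mfinish j) l i =
    [&& 0 < l, l.+1 < j & i == 1] + [&& 0 < l, l.+1 == j & i == 4].
Proof.
move=> hj; rewrite /mfinish; case: eqP => [->|j1]; rewrite ?cexpD cexpMn.
  by rewrite cexp_mb; lia.
by rewrite cexp_mb ?cexp_mf; [|lia..].
Qed.

Lemma bexp_mstart0 j i : 0 < j < n -> bexp (mstart j) 0 i = (i == 1) * d.
Proof.
move=> hj; rewrite /mstart; case: eqP => [_|j1]; rewrite ?bexpD bexpMn.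
  by rewrite bexp_mb; lia.
rewrite bexp_mb ?bexp_ms; [|lia..].
by rewrite (_ : (j == n) = false) ?addn0 //; lia.
Qed.

Lemma bexp_mstart j l i : 0 < j < n -> 0 < l -> bexp (mstart j) l i = 0.
Proof.
move=> hj hl; rewrite /mstart; case: eqP => [_|j1]; rewrite ?bexpD bexpMn.
  by rewrite bexp_mb; lia.
rewrite bexp_mb ?bexp_ms; [|lia..].
by rewrite (_ : (j == n) = false) ?addn0 //; lia.
Qed.

Lemma bexp_mfinish0 j i : 0 < j < n ->
  bexp (mfinish j) 0 i = (i == if j == 1 then 4 else 1) * d.
Proof.
move=> hj; rewrite /mfinish; case: eqP => [_|j1]; rewrite ?bexpD bexpMn.
  by rewrite bexp_mb; lia.
rewrite bexp_mb ?bexp_mf; [|lia..].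
by rewrite (_ : (j == n) = false) ?addn0 //; lia.
Qed.

Lemma bexp_mfinish j l i : 0 < j < n -> 0 < l -> bexp (mfinish j) l i = 0.
Proof.
move=> hj hl; rewrite /mfinish; case: eqP => [_|j1]; rewrite ?bexpD bexpMn.
  by rewrite bexp_mb; lia.
rewrite bexp_mb ?bexp_mf; [|lia..].
by rewrite (_ : (j == n) = false) ?addn0 //; lia.
Qed.

Lemma svE r : 1 < r <= n -> sv k n r = 'X_[ms r].
Proof. by move=> hr; rewrite /sv var_mv //; rewrite /nvars; lia. Qed.

Lemma fvE r : 1 < r <= n -> fv k n r = 'X_[mf r].
Proof. by move=> hr; rewrite /fv var_mv //; rewrite /nvars; lia. Qed.

Lemma bvE j i : j < n -> 0 < i < 5 -> bv k n j i = 'X_[mb j i].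
Proof. by move=> hj hi; rewrite /bv var_mv //; rewrite /nvars; lia. Qed.

Lemma cvE j i : 0 < j < n -> 0 < i < 5 -> cv k n j i = 'X_[mc j i].
Proof. by move=> hj hi; rewrite /cv var_mv //; rewrite /nvars; lia. Qed.

Lemma startE j : 0 < j < n -> start k n d j = 'X_[mstart j].
Proof.
move=> hj; rewrite /start /mstart; case: eqP => [_|j1].
  by rewrite bvE ?mpolyXn //; lia.
by rewrite mpolyXD bvE ?svE ?mpolyXn //; lia.
Qed.

Lemma finishE j : 0 < j < n -> finish k n d j = 'X_[mfinish j].
Proof.
move=> hj; rewrite /finish /mfinish; case: eqP => [_|j1].
  by rewrite bvE ?mpolyXn //; lia.
by rewrite mpolyXD bvE ?fvE ?mpolyXn //; lia.
Qed.

#[local] Opaque ms mf mb mc mstart mfinish cexp bexp.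

Ltac expo := rewrite ?cexpD ?bexpD ?cexpMn ?bexpMn;
  repeat first
    [ rewrite cexp_mstart; last by lia | rewrite bexp_mstart0; last by lia
    | rewrite bexp_mstart; [|lia..]
    | rewrite cexp_mfinish; last by lia | rewrite bexp_mfinish0; last by lia
    | rewrite bexp_mfinish; [|lia..]
    | rewrite cexp_mb; [|lia..] | rewrite bexp_mb; [|lia..]
    | rewrite cexp_mc; [|lia..] | rewrite bexp_mc; [|lia..]
    | rewrite cexp_ms; last by lia | rewrite bexp_ms; last by lia
    | rewrite cexp_mf; last by lia | rewrite bexp_mf; last by lia ].

(** * Invariance of the reached monomials under the generators *)

Definition reached m := valid n d (cexp m) (bexp m).

Definition bound := d ^ 2 ^ n.-1.

Definition invariant u v :=
  forall m, mdeg m < bound -> reached (m + u)%MM = reached (m + v)%MM.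

Lemma reached_start m j u : 0 < j < n ->
    (forall l i, l < j -> cexp u l i = 0) -> (forall l i, l < j -> bexp u l i = 0) ->
  reached (m + (mstart j + u))%MM =
    clean_level (fun=> 0) (bexp m 0) && clean 1 j (cexp m) (bexp m) &&
    run d (n.-1 - j) j 0 (cexp (m + (mstart j + u))%MM) (bexp (m + (mstart j + u))%MM).
Proof.
move=> hj hc hb; apply: valid_start => //.
- by move=> i; expo; rewrite hb; lia.
- by move=> l hl i; expo; rewrite hc; lia.
- by move=> l hl i; expo; rewrite hb; lia.
Qed.

Lemma reached_finish m j u : 0 < j < n ->
    (forall l i, l < j -> cexp u l i = 0) -> (forall l i, l < j -> bexp u l i = 0) ->
  reached (m + (mfinish j + u))%MM =
    clean_level (fun=> 0) (bexp m 0) && clean 1 j (cexp m) (bexp m) &&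
    run d (n.-1 - j) j (d ^ 2 ^ j)
      (cexp (m + (mfinish j + u))%MM) (bexp (m + (mfinish j + u))%MM).
Proof.
move=> hj hc hb; apply: valid_finish => //; first by lia.
- by move=> i; expo; rewrite hb; lia.
- by move=> l hl i; expo; rewrite hc; [case: ifP => ? | ]; lia.
- by move=> l hl i; expo; rewrite hb; lia.
Qed.

Lemma top_or_below j : 0 < j < n ->
  j = n.-1 \/ exists2 t, n.-1 - j = t.+1 & j < n.-1.
Proof.
move=> hj; case: (eqVneq j n.-1) => [->|nj]; first by left.
by right; exists (n.-1 - j).-1; lia.
Qed.

(** At the top level neither side is reached: mode 2 is forbidden, and mode 1 would need b_{n-1,1}
    to the power [bound], which exceeds the degree of the multiplier. Here the degree bound is
    essential. *)
Lemma invariant_finish_c1 j : 0 < j < n ->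
  invariant (mfinish j + mc j 1)%MM (mstart j + mc j 2)%MM.
Proof.
move=> hj m hm; rewrite reached_start ?reached_finish //;
  try by move=> l i hl; expo; lia.
congr (_ && _); have [ej|[t -> jn]] := top_or_below hj.
  rewrite ej subnn /= [RHS](top_ok_mode (i := 2)) //; last by expo; lia.
  apply: top_ok_lt; expo; rewrite /bound in hm.
  by have := @bexp_le m n.-1 1; lia.
by apply: (@run_finish_c1 d t j (cexp m)) => *; try move=> ?; expo; lia.
Qed.

Lemma invariant_finish_c4 j : 0 < j < n ->
  invariant (mfinish j + mc j 4)%MM (mstart j + mc j 3)%MM.
Proof.
move=> hj m hm; rewrite reached_start ?reached_finish //;
  try by move=> l i hl; expo; lia.
congr (_ && _); have [ej|[t -> jn]] := top_or_below hj.
  by rewrite ej subnn /= (top_ok_mode (i := 4)) ?(top_ok_mode (i := 3)) //; expo; lia.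
by apply: (@run_finish_c4 d t j (cexp m)) => *; try move=> ?; expo; lia.
Qed.

Lemma invariant_start_c2 j : 0 < j < n ->
  invariant (mstart j + mc j 3)%MM (mstart j + mc j 2)%MM.
Proof.
move=> hj m hm; rewrite !reached_start //; try by move=> l i hl; expo; lia.
congr (_ && _); have [ej|[t -> jn]] := top_or_below hj.
  by rewrite ej subnn /= (top_ok_mode (i := 3)) ?(top_ok_mode (i := 2)) //; expo; lia.
by apply: (@run_start_c2 d t j (cexp m)) => *; try move=> ?; expo; lia.
Qed.

Lemma invariant_finish_c2 j : 0 < j < n ->
  invariant (mfinish j + (mc j 2 + mb j 1))%MM (mfinish j + (mc j 3 + mb j 4))%MM.
Proof.
move=> hj m hm; rewrite !reached_finish //;
  try by move=> l i hl; expo; lia.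
congr (_ && _); have [ej|[t -> jn]] := top_or_below hj.
  by rewrite ej subnn /= (top_ok_mode (i := 2)) ?(top_ok_mode (i := 3)) //; expo; lia.
by apply: (@run_finish_c2 d t j (cexp m) (bexp m)) => *; try move=> ?; expo; lia.
Qed.

Lemma invariant_finish_c2_next j i : 0 < j < n.-1 -> 0 < i < 5 ->
  invariant (mfinish j + (mc j 2 + mc j.+1 i + mb j 2))%MM
    (mfinish j + (mc j 2 + mc j.+1 i + (mb j.+1 i + mb j 3)))%MM.
Proof.
move=> hj hi m hm; rewrite !reached_finish //; try by [lia | move=> l i' hl; expo; lia].
congr (_ && _); rewrite (_ : n.-1 - j = (n.-1 - j).-1.+1); last by lia.
by apply: (@run_finish_c2_next d _ j (cexp m) (bexp m) _ _ _ _ i) => // *;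
  try move=> ?; expo; lia.
Qed.

Lemma invariant_last :
  invariant (mfinish n.-1 + (mc n.-1 2 + mb n.-1 2))%MM
    (mfinish n.-1 + (mc n.-1 2 + mb n.-1 3))%MM.
Proof.
move=> m hm; rewrite !reached_finish //; try by [lia | move=> l i' hl; expo; lia].
by congr (_ && _); rewrite subnn /= !(top_ok_mode (i := 2)) //; expo; lia.
Qed.

Lemma reached_ext m m' :
  (forall l, cexp m l =1 cexp m' l) -> (forall l, bexp m l =1 bexp m' l) ->
  reached m = reached m'.
Proof.
move=> hc hb; rewrite /reached /valid !hb; congr [&& _, _, _ & _].
by apply: run_ext => l _.
Qed.

Lemma invariant_ext u v :
  (forall l, cexp u l =1 cexp v l) -> (forall l, bexp u l =1 bexp v l) ->
  invariant u v.
Proof.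
by move=> hc hb m _; apply: reached_ext => l i; rewrite ?cexpD ?bexpD ?hc ?hb.
Qed.

(** One more b_04 raises the value entering level 1 by [d], matched by the [d] new factors b_{1i};
    hence [run_shift] with shift [d]. *)
Lemma invariant_first_counter i : 0 < i < 5 ->
  invariant (mc 1 i + mb 0 1)%MM (mc 1 i + (mb 1 i *+ d + mb 0 4))%MM.
Proof.
move=> hi m hm; set u := (m + _)%MM; set v := (m + _)%MM.
have h1 : bexp v 0 1 + bexp v 0 4 = bexp u 0 1 + bexp u 0 4 by rewrite /u /v; expo; lia.
have h2 : bexp v 0 2 = bexp u 0 2 by rewrite /u /v; expo; lia.
have h3 : bexp v 0 3 = bexp u 0 3 by rewrite /u /v; expo; lia.
have h4 : bexp v 0 4 = bexp u 0 4 + 1 by rewrite /u /v; expo; lia.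
rewrite /reached /valid h1 h2 h3 h4 mulnDl mul1n.
rewrite (@run_shift d d i n.-2 1 _ (cexp u) (bexp u)) //.
- by rewrite /u; expo; lia.
- by move=> l hl i'; rewrite /u /v; expo; lia.
- by move=> i'; rewrite /u /v; expo; lia.
- by move=> l hl i'; rewrite /u /v; expo; rewrite (_ : (l == 1) = false) ?mul0n; lia.
Qed.

(** Both monomials contain b_02 or b_03, which no reached monomial does. *)
Lemma invariant_b2_b3 : 
  invariant (mb 0 1 + mb 0 3 *+ d)%MM (mb 0 4 + mb 0 2 *+ d)%MM.
Proof. by move=> m hm; rewrite /reached /valid; expo; lia. Qed.

Lemma invariant_c1_b2 i : 0 < i < 5 ->
  invariant (mc 1 i + mb 0 2)%MM (mc 1 i + (mb 1 i + mb 0 3))%MM.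
Proof. by move=> hi m hm; rewrite /reached /valid; expo; lia. Qed.

Lemma reached_one_c1 m : reached m ->
  cexp m 1 1 + cexp m 1 2 + cexp m 1 3 + cexp m 1 4 = 1.
Proof.
case/and4P => _ _ _; rewrite (_ : n.-2 = (n - 3).+1); last by lia.
by case/andP => /andP [/eqP].
Qed.

(** Two modes at level 1 at once are never reached. *)
Lemma invariant_cc i j : 0 < i < 5 -> 0 < j < 5 ->
  invariant (mc 1 i + mc 1 j + mb 1 i)%MM (mc 1 i + mc 1 j + mb 1 j)%MM.
Proof.
move=> hi hj m _; transitivity false; [|apply: esym];
  by apply/negP => /reached_one_c1; expo; lia.
Qed.

(** After substitution s_n is the start token of the top level in mode 1, with counter value 0 and
    empty registers. *)
Lemma reached_sn : reached (ms n).
Proof.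
have c0 l i : cexp 0%MM l i = 0 by apply: weight0.
have b0 l i : bexp 0%MM l i = 0 by apply: weight0.
rewrite (@reached_ext _ (0 + (mstart n.-1 + mc n.-1 1))%MM); first last.
- move=> l i; rewrite !bexpD b0; case: l => [|l]; first by expo; lia.
  by rewrite bexp_ms ?bexp_mstart ?bexp_mc; lia.
- by move=> l i; rewrite !cexpD c0; expo; lia.
rewrite reached_start; try by [lia | move=> l i hl; expo; lia].
rewrite subnn /= /clean_level /= !b0 /=; apply/andP; split.
  by apply/allP => l _; rewrite /clean_level /= !c0 !b0.
by rewrite /top_ok !cexpD !bexpD !c0 !b0; expo; lia.
Qed.

Lemma not_reached_fn : reached (mf n) = false.
Proof.
have c0 l i : cexp 0%MM l i = 0 by apply: weight0.
have b0 l i : bexp 0%MM l i = 0 by apply: weight0.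
rewrite (@reached_ext _ (0 + (mstart n.-1 + mc n.-1 4))%MM); first last.
- move=> l i; rewrite !bexpD b0; case: l => [|l]; first by expo; lia.
  by rewrite bexp_mf ?bexp_mstart ?bexp_mc; lia.
- by move=> l i; rewrite !cexpD c0; expo; lia.
rewrite reached_start; try by [lia | move=> l i hl; expo; lia].
by rewrite subnn /= (top_ok_mode (i := 4)) ?andbF //; expo; lia.
Qed.

(** * Generators as binomial moves, and the lower bound *)

Local Open Scope ring_scope.

Ltac unX := rewrite ?mpolyXD -?mpolyXn;
  repeat first
    [ rewrite -startE; last by lia | rewrite -finishE; last by lia
    | rewrite -svE; last by lia | rewrite -fvE; last by lia
    | rewrite -bvE; [|lia..] | rewrite -cvE; [|lia..] ].

Definition binomial_move (g : Rn k n) :=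
  exists u v, g = 'X_[u] - 'X_[v] /\ invariant u v.

Lemma binomial_moveI u v g : invariant u v -> g = 'X_[u] - 'X_[v] -> binomial_move g.
Proof. by move=> huv ->; exists u, v. Qed.

Lemma mem_I4 i : i \in I4 -> (0 < i < 5)%N.
Proof. by rewrite mem_iota. Qed.

Lemma KL_gens_binomial g : g \in KL_gens k n d -> binomial_move g.
Proof.
have h1 : (0 < 1 < n)%N by lia.
have hn : (0 < n.-1 < n)%N by lia.
rewrite /KL_gens mem_cat => /orP [|].
  rewrite inE => /eqP ->; apply: (binomial_moveI invariant_b2_b3).
  by unX; ring.
rewrite mem_cat => /orP [|].
  case/mapP => i /mem_I4 hi ->; apply: (binomial_moveI (invariant_c1_b2 hi)).
  by unX; ring.
rewrite mem_cat => /orP [|].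
  case/mapP => i /mem_I4 hi ->; apply: (binomial_moveI (invariant_first_counter hi)).
  by unX; ring.
rewrite mem_cat => /orP [|].
  case/flatten_mapP => i /mem_I4 hi /mapP [j]; rewrite mem_iota => hj ->.
  have hj' : (0 < j < 5)%N by lia.
  by apply: (binomial_moveI (invariant_cc hi hj')); unX; ring.
rewrite mem_cat => /orP [|].
  rewrite !in_cons in_nil orbF => /or4P [] /eqP ->.
  - by apply: (binomial_moveI (invariant_finish_c1 h1)); unX.
  - by apply: (binomial_moveI (invariant_finish_c4 h1)); unX.
  - apply: (binomial_moveI (v := (mstart 1 + mc 1 3)%MM) (u := (mstart 1 + mc 1 2)%MM)).
      by move=> m hm; rewrite (invariant_start_c2 h1).
    by unX; rewrite -mulrBr.
  - by apply: (binomial_moveI (invariant_finish_c2 h1)); unX; rewrite -mulrBr.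
rewrite mem_cat => /orP [|].
  case/mapP => i /mem_I4 hi ->.
  have hn1 : (0 < 1 < n.-1)%N by lia.
  by apply: (binomial_moveI (invariant_finish_c2_next hn1 hi));
    unX; rewrite /finish /=; ring.
rewrite mem_cat => /orP [|].
  rewrite !in_cons in_nil orbF => /orP [] /eqP ->.
    apply: (@binomial_moveI (ms 2) (mc 1 1)); last by unX.
    by apply: invariant_ext => l i; expo; lia.
  apply: (@binomial_moveI (mf 2) (mc 1 4)); last by unX.
  by apply: invariant_ext => l i; expo; lia.
rewrite mem_cat => /orP [|].
  case/flatten_mapP => r; rewrite mem_iota => hr.
  have n0 : (r == n) = false by lia.
  have n1 : (r.-1 == n) = false by lia.
  rewrite !in_cons in_nil orbF => /orP [] /eqP ->.
    apply: (@binomial_moveI (ms r) (ms r.-1 + mc r.-1 1)%MM); last by unX.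
    by apply: invariant_ext => l i; expo; rewrite ?n0 ?n1; lia.
  apply: (@binomial_moveI (mf r) (ms r.-1 + mc r.-1 4)%MM); last by unX.
  by apply: invariant_ext => l i; expo; rewrite ?n0 ?n1; lia.
rewrite mem_cat => /orP [|].
  case/flatten_mapP => r; rewrite mem_iota => hr.
  have hr1 : (0 < r.-1 < n)%N by lia.
  have st : start k n d r.-1 = bv k n 0 1 ^+ d * sv k n r.-1
    by rewrite /start ifN //; lia.
  have fi : finish k n d r.-1 = bv k n 0 1 ^+ d * fv k n r.-1
    by rewrite /finish ifN //; lia.
  rewrite !in_cons in_nil orbF => /or4P [] /eqP ->.
  - by apply: (binomial_moveI (invariant_finish_c1 hr1)); unX; rewrite st fi; ring.
  - by apply: (binomial_moveI (invariant_finish_c4 hr1)); unX; rewrite st fi; ring.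
  - by apply: (binomial_moveI (invariant_start_c2 hr1)); unX; rewrite st; ring.
  - by apply: (binomial_moveI (invariant_finish_c2 hr1)); unX; rewrite fi; ring.
rewrite mem_cat => /orP [|].
  case/flatten_mapP => r; rewrite mem_iota => hr /mapP [i /mem_I4 hi ->].
  have hr1 : (0 < r.-1 < n.-1)%N by lia.
  have er : r.-1.+1 = r by lia.
  have fi : finish k n d r.-1 = bv k n 0 1 ^+ d * fv k n r.-1
    by rewrite /finish ifN //; lia.
  by apply: (binomial_moveI (invariant_finish_c2_next hr1 hi)); unX; rewrite fi er; ring.
have fi : finish k n d n.-1 = bv k n 0 1 ^+ d * fv k n n.-1
    by rewrite /finish ifN //; lia.
have st : start k n d n.-1 = bv k n 0 1 ^+ d * sv k n n.-1
    by rewrite /start ifN //; lia.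
rewrite !in_cons in_nil orbF => /or3P [] /eqP ->.
- apply: (@binomial_moveI (ms n) (mstart n.-1 + mc n.-1 1)%MM).
    apply: invariant_ext => l i; first by expo; lia.
    by case: l => [|l]; expo; lia.
  by unX; rewrite st; ring.
- apply: (@binomial_moveI (mf n) (mstart n.-1 + mc n.-1 4)%MM).
    apply: invariant_ext => l i; first by expo; lia.
    by case: l => [|l]; expo; lia.
  by unX; rewrite st; ring.
by apply: (binomial_moveI invariant_last); unX; rewrite fi; ring.
Qed.

Lemma sn_fn_coefficient (a : 'I_(size (KL_gens k n d)) -> Rn k n) :
  sv k n n - fv k n n = KL_combination a -> exists j, (bound <= tdeg (a j))%N.
Proof.
move=> hcomb; apply/existsP; apply: contraT; rewrite negb_exists => /forallP small.
have : msum reached (sv k n n - fv k n n) = 0.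
  rewrite hcomb /KL_combination (big_morph _ (@msumD k N reached) (@msum0 k N reached)).
  rewrite big1 // => j _.
  have [u [v [-> inv]]] := KL_gens_binomial (mem_nth 0 (ltn_ord j)).
  apply: msum_binomial => m hm; apply: inv.
  have := small j; have := msize_mdeg_lt hm; rewrite /tdeg; lia.
rewrite svE ?fvE; [|lia..].
rewrite msumB !msumX reached_sn not_reached_fn subr0 => /eqP.
by rewrite oner_eq0.
Qed.

Lemma tdeg_sn_fn : tdeg (sv k n n - fv k n n) = 1%N.
Proof.
rewrite svE ?fvE; [|lia..].
have hs : (sidx n < N)%N by rewrite /sidx /nvars; lia.
have hf : (fidx n < N)%N by rewrite /fidx /nvars; lia.
(* The two monomials are told apart by the invariant set: it contains one and not the other. *)
have ne : ms n != mf n.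
  by apply/eqP => h; have := reached_sn; rewrite h not_reached_fn.
have ds : mdeg (ms n) = 1%N by rewrite -[ms n]/(mv (sidx n)) /mv insubT mdeg1.
have df : mdeg (mf n) = 1%N by rewrite -[mf n]/(mv (fidx n)) /mv insubT mdeg1.
apply/eqP; rewrite eqn_leq /tdeg -!subn1 leq_subLR; apply/andP; split.
  rewrite (leq_trans (msizeD_le _ _)) // msizeN !msizeX.
  by rewrite geq_max ds df.
have sup : ms n \in msupp ('X_[ms n] - 'X_[mf n] : Rn k n).
  rewrite mcoeff_msupp mcoeffB !mcoeffX eqxx (eq_sym (mf n)) (negbTE ne).
  by rewrite subr0 oner_eq0.
by have := msize_mdeg_lt sup; rewrite ds; lia.
Qed.

End Exponents.

Theorem theorem1p1 :
  exists c : nat, (0 < c)%N /\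
  forall (k : fieldType) (n d : nat), (3 <= n)%N -> (2 <= d)%N ->
    [/\ in_KL d (sv k n n - fv k n n),
        tdeg (sv k n n - fv k n n) = 1%N &
        forall a : 'I_(size (KL_gens k n d)) -> Rn k n,
          sv k n n - fv k n n = KL_combination a ->
          exists j, (2 ^ (2 ^ (n %/ c)) <= c * (tdeg (a j)).+1)%N].
Proof.
(* The bound obtained is [d ^ 2 ^ n.-1], which for d = 2 is too small for the constant 1; the
   constant 2 works since [n %/ 2 <= n.-1]. *)
exists 2%N; split=> // k n d n3 d2; split.
- exact: sn_fn_in_KL.
- exact: (@tdeg_sn_fn k n d).
move=> a /(sn_fn_coefficient n3 d2) [j hj]; exists j.
have le_half : (n %/ 2 <= n.-1)%N by lia.
apply: (@leq_trans (bound n d)); last by move: (bound n d) hj => b; lia.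
apply: (@leq_trans (2 ^ (2 ^ n.-1))%N); first by rewrite !leq_exp2l.
by rewrite /bound leq_exp2r // expn_gt0.
Qed.
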